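(* Let $(V,\mathscr{B},\mu)$ be a measure space with $\mu$ positive and $\sigma$-finite, $\mathscr{B}_{fin}=\{A\in\mathscr{B}:\mu(A)<\infty\}$, and $K^{(\mu)}(A,B)=\mu(A\cap B)$ for $A,B\in\mathscr{B}_{fin}$. Let $\mathscr{H}(K^{(\mu)})$ be the reproducing kernel Hilbert space of $K^{(\mu)}$ (a Hilbert space of real functions on $\mathscr{B}_{fin}$). Then a function $F:\mathscr{B}_{fin}\to\mathbb{R}$ belongs to $\mathscr{H}(K^{(\mu)})$ if and only if there exists $\varphi\in L^2(\mu)$ with $F(A)=\int_A\varphi\,d\mu$ for all $A\in\mathscr{B}_{fin}$ (i.e. $F$ is a signed measure, absolutely continuous with respect to $\mu$, with Radon–Nikodym derivative $dF/d\mu=\varphi\in L^2(\mu)$). In that case $\varphi$ is unique $\mu$-a.e. and $$\|F\|_{\mathscr{H}(K^{(\mu)})}=\Big\|\frac{dF}{d\mu}\Big\|_{L^2(\mu)}.$$ Moreover every $F\in\mathscr{H}(K^{(\mu)})$ is countably additive: if $A=\bigcup_{i=1}^\infty A_i$ with $A,A_i\in\mathscr{B}_{fin}$ pairwise disjoint, then $F(A)=\sum_{i=1}^\infty F(A_i)$; and $\mu(A)=0$ implies $F(A)=0$.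
   Context: For a p.d. kernel $K$ on a set $S$, $\mathscr{H}(K)$ denotes the unique Hilbert space of functions on $S$ such that $K(\cdot,s)\in\mathscr{H}(K)$ for all $s$ and $F(s)=\langle F,K(\cdot,s)\rangle_{\mathscr{H}(K)}$ for all $F\in\mathscr{H}(K)$, $s\in S$ (reproducing kernel Hilbert space, RKHS). All functions are real valued. *)

(* Defs.v *)
From HB Require Import structures.
From mathcomp Require Import all_boot all_order all_algebra.
From mathcomp Require Import all_classical all_reals all_analysis.
Set Implicit Arguments. Unset Strict Implicit. Unset Printing Implicit Defensive.
Import Order.TTheory GRing.Theory Num.Theory numFieldNormedType.Exports.
Local Open Scope classical_set_scope.
Local Open Scope ring_scope.

(* A reproducing kernel Hilbert space for a kernel K on a set S, following
   the definition in the paper: a (real) Hilbert space of functions on S,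
   containing every K(.,s), with the reproducing property.  The space is
   given by its carrier [rk_mem] (a linear subspace of S -> R) and its inner
   product [rk_inner] (only meaningful on the carrier). *)
Record RKHS (R : realType) (S : Type) (K : S -> S -> R) := {
  rk_mem : set (S -> R);
  rk_inner : (S -> R) -> (S -> R) -> R;
  rk_mem0 : rk_mem (fun _ => 0);
  rk_memD : forall f g, rk_mem f -> rk_mem g -> rk_mem (fun s => f s + g s);
  rk_memZ : forall (a : R) f, rk_mem f -> rk_mem (fun s => a * f s);
  rk_innerC : forall f g, rk_mem f -> rk_mem g -> rk_inner f g = rk_inner g f;
  rk_innerDl : forall f g h, rk_mem f -> rk_mem g -> rk_mem h ->
    rk_inner (fun s => f s + g s) h = rk_inner f h + rk_inner g h;
  rk_innerZl : forall (a : R) f g, rk_mem f -> rk_mem g ->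
    rk_inner (fun s => a * f s) g = a * rk_inner f g;
  rk_inner_ge0 : forall f, rk_mem f -> 0 <= rk_inner f f;
  rk_inner_eq0 : forall f, rk_mem f -> rk_inner f f = 0 -> f = (fun _ => 0);
  rk_complete : forall u : nat -> (S -> R), (forall n, rk_mem (u n)) ->
    (forall e : R, 0 < e -> exists N : nat, forall m n : nat, (N <= m)%N -> (N <= n)%N ->
       rk_inner (fun s => u m s - u n s) (fun s => u m s - u n s) < e) ->
    exists2 g, rk_mem g &
      (fun n : nat => rk_inner (fun s => u n s - g s) (fun s => u n s - g s)) @ \oo --> (0 : R);
  rk_kernel_mem : forall t, rk_mem (fun s => K s t);
  rk_reproducing : forall f t, rk_mem f -> f t = rk_inner f (fun s => K s t)
}.

Definition rk_norm (R : realType) (S : Type) (K : S -> S -> R) (H : RKHS K)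
  (f : S -> R) : R := Num.sqrt (rk_inner H f f).

Definition Bfin d (T : measurableType d) (R : realType)
  (mu : {measure set T -> \bar R}) : Type :=
  {A : set T | measurable A /\ (mu A < +oo)%E}.

Definition Kmu d (T : measurableType d) (R : realType)
  (mu : {measure set T -> \bar R}) (A B : Bfin mu) : R :=
  fine (mu (sval A `&` sval B)).

Definition L2 d (T : measurableType d) (R : realType)
  (mu : {measure set T -> \bar R}) (phi : T -> R) : Prop :=
  measurable_fun setT phi /\ (Lnorm mu 2%:E (EFin \o phi) < +oo)%E.

Definition L2norm d (T : measurableType d) (R : realType)
  (mu : {measure set T -> \bar R}) (phi : T -> R) : R :=
  fine (Lnorm mu 2%:E (EFin \o phi)).

Arguments Bfin {d T R} mu.
Arguments Kmu {d T R} mu A B.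
Arguments L2 {d T R} mu phi.
Arguments L2norm {d T R} mu phi.

(* Main.v *)
Require Import Defs.
From HB Require Import structures.
From mathcomp Require Import all_boot all_order all_algebra.
From mathcomp Require Import all_classical all_reals all_analysis.
From mathcomp Require Import measurable_realfun ring lra.
Import Order.TTheory GRing.Theory Num.Theory numFieldNormedType.Exports.
Local Open Scope classical_set_scope.
Local Open Scope ring_scope.

(** Write [J phi] for the set function [A |-> \int_A phi].  Since [J 1_A] is the
    kernel function [K(., A)], the reproducing property makes [J] isometric on
    simple functions, and completeness of the RKHS extends this to all of L2:
    this gives one inclusion, the norm identity and uniqueness of the density.
    Conversely, for [F] in the RKHS, [K(., A \cup B) = K(., A) + K(., B)] for
    disjoint [A], [B] and [|F A|^2 <= |F|^2 * mu A] make [F] a signed measure,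
    absolutely continuous on sets of finite measure.  Radon-Nikodym on a
    countable partition yields a local density [phi].  If [psi] is [phi] cut off
    to a set [E] of finite measure on which it is bounded, then [F - J psi]
    vanishes on the subsets of [E], hence is orthogonal to [J psi], so
    [|psi|_2 <= |F|] by Cauchy-Schwarz; letting [E] grow gives [phi] in L2. *)

(** Common source of the Cauchy-Schwarz inequalities in L2 and in the RKHS, where [a], [b], [c] are
    the squared norm of [f], the product of [f] and [g], and the squared norm of [g]. For [c > 0]
    evaluate at the minimizer [- b / c]; for [c = 0] an affine function bounded below has slope
    zero. *)
Lemma nonneg_quadratic_discriminant (R : realFieldType) (a b c : R) : 0 <= c ->
  (forall t, 0 <= a + 2 * t * b + t ^+ 2 * c) -> b ^+ 2 <= a * c.
Proof.
rewrite le_eqVlt => /predU1P[<-|c0] h.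
  have [->|b0] := eqVneq b 0; first by rewrite mulr0 expr0n.
  (* At this [t] the affine function takes the value -1. *)
  have := h (- (a + 1) / (2 * b)).
  have -> : a + 2 * (- (a + 1) / (2 * b)) * b +
    (- (a + 1) / (2 * b)) ^+ 2 * 0 = -1 by field.
  by rewrite lerNr oppr0 ler10.
have := h (- b / c).
have -> : a + 2 * (- b / c) * b + (- b / c) ^+ 2 * c = (a * c - b ^+ 2) / c.
  by field; rewrite gt_eqF.
by rewrite pmulr_lge0 ?invr_gt0// subr_ge0.
Qed.

(** * Inner product, dominated convergence and an induction principle on L2 *)

Section square_integrable_functions.
Set Implicit Arguments. Unset Strict Implicit.
Context d (T : measurableType d) (R : realType).
Variable mu : {measure set T -> \bar R}.
Implicit Types f g h : T -> R.

Definition dotL2 f g : R := \int[mu]_x (f x * g x).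

Lemma L2P f : L2 mu f <-> f \in Lfun mu 2%:E.
Proof.
split=> [[mf lf]|/[!inE]/andP[]]; last by rewrite !inE.
by rewrite inE; apply/andP; rewrite !inE.
Qed.

Lemma L2_integrableM f g : L2 mu f -> L2 mu g ->
  mu.-integrable setT (EFin \o (fun x => f x * g x)).
Proof.
by move=> /L2P lf /L2P lg; apply/Lfun1_integrable; exact: Lfun2_mul_Lfun1.
Qed.

Lemma Lnorm2E f : measurable_fun setT f ->
  Lnorm mu 2%:E (EFin \o f) = ((\int[mu]_x (f x * f x)%:E) `^ 2^-1)%E.
Proof.
move=> mf; rewrite unlock; congr (_ `^ _)%E; apply: eq_integral => x _ /=.
by rewrite powR_mulrn// real_normK ?num_real// expr2.
Qed.

Lemma L2_sqrP f : measurable_fun setT f ->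
  L2 mu f <-> (\int[mu]_x (f x * f x)%:E < +oo)%E.
Proof.
move=> mf; split.
  move=> lf; have := L2_integrableM lf lf; exact: integrable_lty.
move=> foo; split => //; rewrite Lnorm2E//; exact: poweR_lty.
Qed.

Lemma L2_le f g : measurable_fun setT f -> (forall x, `|f x| <= `|g x|) ->
  L2 mu g -> L2 mu f.
Proof.
move=> mf fg lg; have [mg _] := lg; apply/(L2_sqrP mf).
apply: le_lt_trans ((L2_sqrP mg).1 lg); apply: ge0_le_integral => //.
- by move=> x _; rewrite lee_fin -expr2 sqr_ge0.
- by apply/measurable_EFinP; exact: measurable_funM.
- by apply/measurable_EFinP; exact: measurable_funM.
- move=> x _; rewrite lee_fin -!expr2 -[leLHS]real_normK ?num_real//.
  by rewrite -[leRHS]real_normK ?num_real// lerXn2r ?nnegrE.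
Qed.

Lemma L2D f g : L2 mu f -> L2 mu g -> L2 mu (fun x => f x + g x).
Proof.
move=> /L2P lf /L2P lg; apply/L2P.
by apply: (@Lfun_addr_closed _ _ _ mu 2%:E _).2 => //; rewrite lee1n.
Qed.

Lemma L2Z a f : L2 mu f -> L2 mu (fun x => a * f x).
Proof.
move=> /L2P lf; apply/L2P.
by under eq_fun do rewrite mulrC; apply: Lfun_scale => //; rewrite ler1n.
Qed.

Lemma L2B f g : L2 mu f -> L2 mu g -> L2 mu (fun x => f x - g x).
Proof.
move=> lf lg; have := L2D lf (L2Z (-1) lg).
by under eq_fun do rewrite mulN1r.
Qed.

Lemma L2_indic (A : Bfin mu) : L2 mu \1_(sval A).
Proof.
have [mA Aoo] := svalP A.
have mi : measurable_fun setT (\1_(sval A) : T -> R) by exact: measurable_indic.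
apply/(L2_sqrP mi); rewrite (eq_integral (fun x => (\1_(sval A) x)%:E)).
  by rewrite integral_indic// setIT.
by move=> x _; rewrite indicE; case: (_ \in _); rewrite ?mulr1 ?mulr0.
Qed.

Lemma dotL2C f g : dotL2 f g = dotL2 g f.
Proof. by apply: eq_Rintegral => x _; rewrite mulrC. Qed.

Lemma dotL2Dl f g h : L2 mu f -> L2 mu g -> L2 mu h ->
  dotL2 (fun x => f x + g x) h = dotL2 f h + dotL2 g h.
Proof.
move=> lf lg lh; rewrite /dotL2 -RintegralD//; last 2 first.
- exact: L2_integrableM.
- exact: L2_integrableM.
by apply: eq_Rintegral => x _; rewrite mulrDl.
Qed.

Lemma dotL2Zl a f h : L2 mu f -> L2 mu h ->
  dotL2 (fun x => a * f x) h = a * dotL2 f h.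
Proof.
move=> lf lh; rewrite /dotL2 -RintegralZl//; last exact: L2_integrableM.
by apply: eq_Rintegral => x _; rewrite mulrA.
Qed.

Lemma dotL2Bl f g h : L2 mu f -> L2 mu g -> L2 mu h ->
  dotL2 (fun x => f x - g x) h = dotL2 f h - dotL2 g h.
Proof.
move=> lf lg lh; rewrite -[- dotL2 g h]mulN1r -dotL2Zl// -dotL2Dl//.
  by apply: eq_Rintegral => x _; rewrite mulN1r.
exact: L2Z.
Qed.

Lemma dotL2_ge0 f : 0 <= dotL2 f f.
Proof. by apply: Rintegral_ge0 => x _; rewrite -expr2 sqr_ge0. Qed.

(** Parallelogram law with the squared norm of [f + g] dropped. It turns convergence in L2 into the
    Cauchy property. *)
Lemma dotL2B_le f g : L2 mu f -> L2 mu g ->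
  dotL2 (fun x => f x - g x) (fun x => f x - g x) <=
  2 * (dotL2 f f + dotL2 g g).
Proof.
move=> lf lg; have lB := L2B lf lg; have lD := L2D lf lg.
have := dotL2_ge0 (fun x => f x + g x).
rewrite dotL2Bl// dotL2Dl// !(dotL2C _ (fun x => f x + g x)).
rewrite !(dotL2C _ (fun x => f x - g x)) !dotL2Bl// !dotL2Dl// (dotL2C g f).
by lra.
Qed.

Lemma dotL2_norm f : L2 mu f -> L2norm mu f = Num.sqrt (dotL2 f f).
Proof.
move=> lf; have [mf _] := lf; rewrite /L2norm Lnorm2E//.
rewrite -[X in (X `^ _)%E]fineK; last exact/integrable_fin_num/L2_integrableM.
by rewrite poweR_EFin /= powR12_sqrt// dotL2_ge0.
Qed.

Lemma dotL2_cauchy_schwarz f g : L2 mu f -> L2 mu g ->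
  dotL2 f g ^+ 2 <= dotL2 f f * dotL2 g g.
Proof.
move=> lf lg; apply: nonneg_quadratic_discriminant (dotL2_ge0 g) _ => t.
have := dotL2_ge0 (fun x => f x + t * g x).
have ltg := L2Z t lg; have lfg := L2D lf ltg.
rewrite dotL2Dl// dotL2Zl// (dotL2C f) (dotL2C g) !dotL2Dl// !dotL2Zl//.
rewrite (dotL2C g f); congr (_ <= _); ring.
Qed.

Lemma dotL2_indic f (A : Bfin mu) :
  dotL2 f \1_(sval A) = Rintegral mu (sval A) f.
Proof.
rewrite Rintegral_mkcond; apply: eq_Rintegral => x _.
by rewrite patchE indicE; case: ifPn => _; rewrite ?mulr1 ?mulr0.
Qed.

(** Since [|u n - f| <= 2 * |f|], the squared differences are dominated by the integrable function
    [4 * f ^+ 2]. *)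
Lemma dotL2_dominated_cvg (u : nat -> T -> R) f :
  (forall n, L2 mu (u n)) -> L2 mu f ->
  (forall n x, `|u n x| <= `|f x|) ->
  (forall x, u^~ x @ \oo --> f x) ->
  dotL2 (fun x => u n x - f x) (fun x => u n x - f x) @[n --> \oo] --> (0 : R).
Proof.
move=> lu lf uf cu; have mu' n := (lu n).1; have mf := lf.1.
have mB n : measurable_fun setT (fun x => u n x - f x) by exact: measurable_funB.
have [] := @dominated_convergence _ _ _ mu setT measurableT
  (fun n x => ((u n x - f x) * (u n x - f x))%:E) (cst 0%E)
  (fun x => (4 * (f x * f x))%:E).
- by move=> n; apply/measurable_EFinP; exact: measurable_funM.
- exact: measurable_cst.
- apply: nearW => x _; apply/cvg_EFin; first exact: nearW.
  have c0 : u n x - f x @[n --> \oo] --> (0 : R).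
    by rewrite -(subrr (f x)); apply: cvgB => //; exact: cvg_cst.
  by rewrite -[X in _ --> X](mulr0 0); apply: cvgM.
- have := @integrableZl _ _ _ mu setT measurableT 4 _ (L2_integrableM lf lf).
  by apply: eq_integrable => // x _ /=; rewrite EFinM.
- apply: nearW => x n _; rewrite lee_fin normrM.
  have : `|u n x - f x| <= 2 * `|f x|.
    by rewrite (le_trans (ler_normB _ _))// mulrDl mul1r lerD.
  move=> /[dup] h /(ler_pM (normr_ge0 _) (normr_ge0 _) h) /le_trans; apply.
  by rewrite -[X in _ <= _ * X]expr2 -[X in _ <= _ * X]real_normK ?num_real//; lra.
- move=> _ _; rewrite integral_cst// mul0e => /fine_cvg h; exact: h.
Qed.

Import HBSimple HBNNSimple.

(** Linearity reaches the simple functions in L2, increasing approximation the nonnegative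
    functions, and the splitting into positive and negative parts all of L2. It serves both for the
    isometry and for the orthogonality argument. *)
Theorem L2_induction (P : (T -> R) -> Prop) :
  (forall A : Bfin mu, P \1_(sval A)) ->
  (forall f g, L2 mu f -> L2 mu g -> P f -> P g -> P (fun x => f x + g x)) ->
  (forall a f, L2 mu f -> P f -> P (fun x => a * f x)) ->
  (forall (u : nat -> T -> R) f, (forall n, L2 mu (u n)) -> L2 mu f ->
     (forall n, P (u n)) ->
     dotL2 (fun x => u n x - f x) (fun x => u n x - f x) @[n --> \oo]
       --> (0 : R) -> P f) ->
  forall f, L2 mu f -> P f.
Proof.
move=> Pi PD PZ Plim.
have set0P : measurable (set0 : set T) /\ (mu set0 < +oo)%E.
  by rewrite measure0; split => //; exact: measurable0.
pose B0 : Bfin mu := exist _ set0 set0P.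
have L0 : L2 mu (fun _ => 0).
  by have := L2Z 0 (L2_indic B0); under eq_fun do rewrite mul0r.
have P0 : P (fun _ => 0).
  by have := PZ 0 _ (L2_indic B0) (Pi B0); under eq_fun do rewrite mul0r.
have simple (s : {nnsfun T >-> R}) : L2 mu s -> P s.
  move=> ls.
  (* The level set of 0 may have infinite measure, but its term vanishes. For [y != 0] the indicator
     of the level set is dominated by [y^-1 * s], which is in L2, so the level set has finite
     measure. *)
  have term y : L2 mu (fun x => y * \1_(s @^-1` [set y]) x) /\
      P (fun x => y * \1_(s @^-1` [set y]) x).
    have [->|y0] := eqVneq y 0.
      by split; under eq_fun do rewrite mul0r.
    have my : measurable (s @^-1` [set y]) by exact: measurable_sfunP.
    have my1 : measurable_fun setT (\1_(s @^-1` [set y]) : T -> R).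
      exact: measurable_indic.
    have ly : L2 mu (\1_(s @^-1` [set y])).
      apply: L2_le my1 _ (L2Z y^-1 ls) => x; rewrite indicE.
      case: (boolP (x \in _)) => [|_]; last by rewrite normr0.
      by rewrite inE /= => ->; rewrite mulVf.
    have yoo : (mu (s @^-1` [set y]) < +oo)%E.
      move/(L2_sqrP my1): ly.
      rewrite (eq_integral (fun x => (\1_(s @^-1` [set y]) x)%:E)).
        by rewrite integral_indic// setIT.
      by move=> x _; rewrite indicE; case: (_ \in _); rewrite ?mulr1 ?mulr0.
    split; first exact: L2Z.
    exact: PZ ly (Pi (exist _ _ (conj my yoo))).
  have sumP (l : seq R) :
      L2 mu (fun x => \sum_(y <- l) y * \1_(s @^-1` [set y]) x) /\
      P (fun x => \sum_(y <- l) y * \1_(s @^-1` [set y]) x).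
    elim: l => [|y l [ll Pl]].
      by split; under eq_fun do rewrite big_nil.
    have [ly Py] := term y.
    by split; under eq_fun do rewrite big_cons; [exact: L2D|exact: PD].
  have -> : (s : T -> R) = fun x => \sum_(y <- finmap.enum_fset (fset_set (range s)))
      y * \1_(s @^-1` [set y]) x.
    by apply/funext => x; rewrite [LHS]fimfunE fsbig_finite.
  exact: (sumP _).2.
have nonneg f : L2 mu f -> (forall x, 0 <= f x) -> P f.
  move=> lf f0; have mf : measurable_fun setT (EFin \o f).
    by apply/measurable_EFinP; exact: lf.1.
  (* These simple functions increase to [f], so they are dominated by [f]: they lie in L2 and
     converge to [f] there. *)
  pose s n : T -> R := nnsfun_approx measurableT mf n.
  have cs x : s^~ x @ \oo --> f x.
    have := @cvg_nnsfun_approx _ _ _ _ measurableT _ mf (fun x _ => f0 x) x I.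
    by move=> /fine_cvgP[].
  have sf n x : `|s n x| <= `|f x|.
    rewrite (ger0_norm (f0 x)) ger0_norm; last exact: fun_ge0.
    rewrite -(cvg_lim (@Rhausdorff R) (cs x)).
    apply: nondecreasing_cvgn_le; last by apply/cvg_ex; exists (f x); exact: cs.
    by move=> m n' mn; exact/lefP/nd_nnsfun_approx.
  have ls n : L2 mu (s n) by apply: L2_le (sf n) lf; exact: measurable_funP.
  apply: (Plim s) => //; first by move=> n; apply: simple; exact: ls.
  exact: dotL2_dominated_cvg.
move=> f lf; have mf := lf.1.
have lp : L2 mu f^\+.
  by apply: L2_le lf; [exact: measurable_funrpos|move=> x]; rewrite /funrpos
    ger0_norm ?le_max ?lexx ?orbT// ge_max ler_norm normr_ge0.
have ln : L2 mu f^\-.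
  by apply: L2_le lf; [exact: measurable_funrneg|move=> x]; rewrite /funrneg
    ger0_norm ?le_max ?lexx ?orbT// ge_max -normrN ler_norm normr_ge0.
have -> : f = fun x => f^\+ x + -1 * f^\- x.
  by rewrite -[LHS]funrposBneg; apply/funext => x; rewrite mulN1r.
apply: PD => //; first exact: L2Z.
- by apply: nonneg => // x; rewrite le_max lexx orbT.
- by apply: PZ => //; apply: nonneg => // x; rewrite le_max lexx orbT.
Qed.

End square_integrable_functions.

(** Shaped for Cauchy-Schwarz: [a n] is the product of a moving vector with a fixed one, [b n] and
    [c] are their squared norms. *)
Lemma cvg0_sqr_le (R : realType) (a b : nat -> R) (c : R) :
  (forall n, a n ^+ 2 <= b n * c) -> b @ \oo --> 0 -> a @ \oo --> 0.
Proof.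
move=> ab b0; apply/norm_cvg0P.
have sq0 : Num.sqrt (b n * c) @[n --> \oo] --> (0 : R).
  rewrite -[X in _ --> X]sqrtr0; apply: continuous_cvg.
    exact: sqrt_continuous.
  by rewrite -[X in _ --> X](mul0r c); apply: cvgMl.
apply: (squeeze_cvgr _ (cvg_cst 0) sq0); apply: nearW => n.
by rewrite normr_ge0 -sqrtr_sqr ler_wsqrtr.
Qed.

(** * Cauchy-Schwarz and continuity of the inner product in an RKHS *)

Section rkhs_theory.
Set Implicit Arguments. Unset Strict Implicit.
Context (R : realType) (S : Type) (K : S -> S -> R) (H : RKHS K).
Implicit Types f g h : S -> R.

Lemma rk_memB f g : rk_mem H f -> rk_mem H g -> rk_mem H (fun s => f s - g s).
Proof.
move=> Hf Hg; have := rk_memD Hf (rk_memZ (-1) Hg).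
by under eq_fun do rewrite mulN1r.
Qed.

Lemma rk_innerBl f g h : rk_mem H f -> rk_mem H g -> rk_mem H h ->
  rk_inner H (fun s => f s - g s) h = rk_inner H f h - rk_inner H g h.
Proof.
move=> Hf Hg Hh; have := rk_innerDl Hf (rk_memZ (-1) Hg) Hh.
by under eq_fun do rewrite mulN1r; move=> ->; rewrite rk_innerZl// mulN1r.
Qed.

Lemma rk_cauchy_schwarz f g : rk_mem H f -> rk_mem H g ->
  rk_inner H f g ^+ 2 <= rk_inner H f f * rk_inner H g g.
Proof.
move=> Hf Hg.
apply: nonneg_quadratic_discriminant (rk_inner_ge0 Hg) _ => t.
have Htg := rk_memZ t Hg; have Hftg := rk_memD Hf Htg.
have := rk_inner_ge0 Hftg.
rewrite rk_innerDl// rk_innerZl// (rk_innerC Hf Hftg) (rk_innerC Hg Hftg).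
rewrite !rk_innerDl// !rk_innerZl// (rk_innerC Hg Hf).
congr (_ <= _); ring.
Qed.

Lemma rk_cvg_inner (u : nat -> S -> R) g h :
  (forall n, rk_mem H (u n)) -> rk_mem H g -> rk_mem H h ->
  rk_inner H (fun s => u n s - g s) (fun s => u n s - g s) @[n --> \oo]
    --> (0 : R) ->
  rk_inner H (u n) h @[n --> \oo] --> rk_inner H g h.
Proof.
move=> Hu Hg Hh /(@cvg0_sqr_le R (fun n => rk_inner H (u n) h - rk_inner H g h)
  _ (rk_inner H h h)) => /(_ _)/cvg_sub0; apply; last exact: cvg_cst.
by move=> n; rewrite -rk_innerBl//; apply: rk_cauchy_schwarz => //; exact: rk_memB.
Qed.

End rkhs_theory.

(** * The isometry from L2 into the RKHS *)

Section rkhs_of_measure.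
Set Implicit Arguments. Unset Strict Implicit.
Context d (T : measurableType d) (R : realType).
Variable mu : {measure set T -> \bar R}.
Implicit Types phi psi : T -> R.

Definition integral_on phi (A : Bfin mu) : R := Rintegral mu (sval A) phi.

Lemma integral_onE phi : integral_on phi = fun A => dotL2 mu phi \1_(sval A).
Proof. by apply/funext => A; rewrite dotL2_indic. Qed.

Lemma integral_onD phi psi : L2 mu phi -> L2 mu psi ->
  integral_on (fun x => phi x + psi x) =
  fun A => integral_on phi A + integral_on psi A.
Proof.
move=> lf lg; rewrite !integral_onE; apply/funext => A.
by rewrite dotL2Dl//; exact: L2_indic.
Qed.

Lemma integral_onZ a phi : L2 mu phi ->
  integral_on (fun x => a * phi x) = fun A => a * integral_on phi A.
Proof.
move=> lf; rewrite !integral_onE; apply/funext => A.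
by rewrite dotL2Zl//; exact: L2_indic.
Qed.

Lemma integral_onB phi psi : L2 mu phi -> L2 mu psi ->
  integral_on (fun x => phi x - psi x) =
  fun A => integral_on phi A - integral_on psi A.
Proof.
move=> lf lg; rewrite !integral_onE; apply/funext => A.
by rewrite dotL2Bl//; exact: L2_indic.
Qed.

Lemma integral_on_indic (A : Bfin mu) :
  integral_on \1_(sval A) = fun B => Kmu mu B A.
Proof.
apply/funext => B; have [mA _] := svalP A; have [mB _] := svalP B.
by rewrite /integral_on /Rintegral integral_indic// setIC.
Qed.

Variable H : RKHS (Kmu mu).

(** Testing against every [psi], and not only [phi] itself, makes the condition linear in [phi], as
    the induction requires. Membership of the image of [psi] is assumed because it is not yet known
    for all of L2 and [rk_inner] is meaningful only on the carrier. *)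
Let isometric phi := rk_mem H (integral_on phi) /\
  forall psi, L2 mu psi -> rk_mem H (integral_on psi) ->
    rk_inner H (integral_on psi) (integral_on phi) = dotL2 mu psi phi.

Let isometric_indic (A : Bfin mu) : isometric \1_(sval A).
Proof.
rewrite /isometric integral_on_indic; split; first exact: rk_kernel_mem.
by move=> psi lpsi Hpsi; rewrite -rk_reproducing// dotL2_indic.
Qed.

Let isometricD phi psi : L2 mu phi -> L2 mu psi ->
  isometric phi -> isometric psi -> isometric (fun x => phi x + psi x).
Proof.
move=> lf lg [Hf If] [Hg Ig]; rewrite /isometric integral_onD//; split.
  exact: rk_memD.
move=> h lh Hh; have Hfg := rk_memD Hf Hg.
rewrite rk_innerC// rk_innerDl// (rk_innerC Hf)// (rk_innerC Hg)//.
by rewrite If// Ig// !(dotL2C mu h) dotL2Dl.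
Qed.

Let isometricZ a phi : L2 mu phi -> isometric phi ->
  isometric (fun x => a * phi x).
Proof.
move=> lf [Hf If]; rewrite /isometric integral_onZ//; split.
  exact: rk_memZ.
move=> h lh Hh; have Haf := rk_memZ a Hf.
by rewrite rk_innerC// rk_innerZl// (rk_innerC Hf)// If// !(dotL2C mu h) dotL2Zl.
Qed.

Let isometricB phi psi : L2 mu phi -> L2 mu psi ->
  isometric phi -> isometric psi -> isometric (fun x => phi x - psi x).
Proof.
move=> lf lg If Ig; have := isometricD lf (L2Z (-1) lg) If (isometricZ (-1) lg Ig).
by under eq_fun do rewrite mulN1r.
Qed.

(** The images of [u n] form a Cauchy sequence, so they have a limit [g] in the RKHS. Evaluation at
    a set is an inner product on both sides, which identifies [g] with the image of [phi]; the inner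
    products then pass to the limit. *)
Let isometric_cvg (u : nat -> T -> R) phi :
  (forall n, L2 mu (u n)) -> L2 mu phi -> (forall n, isometric (u n)) ->
  dotL2 mu (fun x => u n x - phi x) (fun x => u n x - phi x) @[n --> \oo]
    --> (0 : R) ->
  isometric phi.
Proof.
move=> lu lf Iu u0; have Hu n := (Iu n).1.
have lB n : L2 mu (fun x => u n x - phi x) by exact: L2B.
have dot_cvg h : L2 mu h -> dotL2 mu (u n) h @[n --> \oo] --> dotL2 mu phi h.
  move=> lh; move: u0 => /(@cvg0_sqr_le R
    (fun n => dotL2 mu (u n) h - dotL2 mu phi h) _ (dotL2 mu h h)).
  move=> /(_ _)/cvg_sub0; apply; last exact: cvg_cst.
  by move=> n; rewrite -dotL2Bl//; exact: dotL2_cauchy_schwarz.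
have [eps eps0|g Hg ug] :=
    @rk_complete _ _ _ H (fun n => integral_on (u n)) Hu.
  (* [dotL2B_le] bounds the squared distance of two terms by [2 * (eps / 4 + eps / 4)], strictly. *)
  have /cvgrPdist_lt/(_ (eps / 4))[|N _ eN] := u0; first by rewrite divr_gt0.
  exists N => m n Nm Nn; rewrite -integral_onB//.
  have lmn : L2 mu (fun x => u m x - u n x) by exact: L2B.
  have Imn := isometricB (lu m) (lu n) (Iu m) (Iu n).
  rewrite Imn.2//; last exact: Imn.1.
  have -> : (fun x => u m x - u n x) =
      (fun x => (u m x - phi x) - (u n x - phi x)).
    by apply/funext => x; rewrite opprB addrA subrK.
  apply: le_lt_trans (dotL2B_le (lB m) (lB n)) _.
  have := eN _ Nm; have := eN _ Nn; rewrite !sub0r !normrN.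
  by rewrite !ger0_norm ?dotL2_ge0//; lra.
have gE : integral_on phi = g.
  apply/funext => A; rewrite (rk_reproducing A Hg).
  have HA := rk_kernel_mem H A.
  have c1 : dotL2 mu (u n) \1_(sval A) @[n --> \oo]
      --> rk_inner H g (fun s => Kmu mu s A).
    apply: cvg_trans (rk_cvg_inner Hu Hg HA ug).
    apply: near_eq_cvg; apply: nearW => n.
    by rewrite -rk_reproducing// dotL2_indic.
  rewrite integral_onE.
  exact: (cvg_unique (@Rhausdorff R) (dot_cvg _ (L2_indic A)) c1).
rewrite /isometric gE; split => // psi lpsi Hpsi.
rewrite rk_innerC// (dotL2C _ psi).
apply: (cvg_unique (@Rhausdorff R) (rk_cvg_inner Hu Hg Hpsi ug)).
apply: cvg_trans (dot_cvg _ lpsi); apply: near_eq_cvg; apply: nearW => n.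
by rewrite [RHS]rk_innerC// (Iu n).2// dotL2C.
Qed.

Let L2_isometric phi : L2 mu phi -> isometric phi.
Proof. exact: (L2_induction isometric_indic isometricD isometricZ isometric_cvg). Qed.

Theorem rk_mem_integral_on phi : L2 mu phi -> rk_mem H (integral_on phi).
Proof. by move=> /L2_isometric[]. Qed.

Theorem rk_inner_integral_on phi psi : L2 mu phi -> L2 mu psi ->
  rk_inner H (integral_on phi) (integral_on psi) = dotL2 mu phi psi.
Proof.
by move=> lf lg; apply: (L2_isometric lg).2 => //; exact: rk_mem_integral_on.
Qed.

(** By the isometry the squared L2 norm of [phi - psi] is that of the zero function. *)
Theorem integral_on_inj phi psi : L2 mu phi -> L2 mu psi ->
  integral_on phi = integral_on psi -> phi = psi %[ae mu].
Proof.
move=> lf lg fg; have lB := L2B lf lg; have [mB _] := lB.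
have B0 : dotL2 mu (fun x => phi x - psi x) (fun x => phi x - psi x) = 0.
  rewrite -rk_inner_integral_on// integral_onB// fg -integral_onB//.
  rewrite rk_inner_integral_on//; last 2 first.
  - exact: L2B.
  - exact: L2B.
  rewrite /dotL2 (@eq_Rintegral _ _ _ mu setT (fun=> 0)); first by rewrite Rintegral_cst// mul0r.
  by move=> x _; rewrite subrr mulr0.
have : (\int[mu]_x `|((phi x - psi x) * (phi x - psi x))%:E| = 0)%E.
  rewrite (eq_integral (fun x => ((phi x - psi x) * (phi x - psi x))%:E)).
    rewrite -[LHS]fineK; last by apply: integrable_fin_num => //; exact: L2_integrableM.
    by congr EFin.
  by move=> x _; rewrite gee0_abs// lee_fin -expr2 sqr_ge0.
have mBB : measurable_fun setT
    (fun x => ((phi x - psi x) * (phi x - psi x))%:E).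
  by apply/measurable_EFinP; exact: measurable_funM.
move/(ae_eq_integral_abs mu measurableT mBB); apply: filterS.
move=> x /= h _; have := h I => /eqP; rewrite eqe mulf_eq0 orbb subr_eq0.
by move=> /eqP.
Qed.

End rkhs_of_measure.
Arguments integral_on {d T R} mu phi A.

(** * Members of the RKHS as countably additive set functions *)

Section rkhs_set_functions.
Set Implicit Arguments. Unset Strict Implicit.
Context d (T : measurableType d) (R : realType).
Variable mu : {measure set T -> \bar R}.
Variable H : RKHS (Kmu mu).
Implicit Types (F G : Bfin mu -> R) (A B C : Bfin mu).

Lemma Bfin_inj A B : sval A = sval B -> A = B.
Proof.
case: A B => [A pA] [B pB] /= AB; rewrite AB in pA *.
by congr exist; exact: Prop_irrelevance.
Qed.

Lemma measurable_Bfin A : measurable (sval A).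
Proof. exact: (svalP A).1. Qed.

Lemma Bfin_fin_num A : mu (sval A) \is a fin_num.
Proof. by rewrite ge0_fin_numE//; exact: (svalP A).2. Qed.

Lemma Bfin_subset A (B : set T) : measurable B -> B `<=` sval A ->
  measurable B /\ (mu B < +oo)%E.
Proof.
move=> mB BA; split => //; apply: le_lt_trans (svalP A).2.
by apply: le_measure => //; rewrite inE//; exact: measurable_Bfin.
Qed.

Definition Bfin_setIr (B : set T) (mB : measurable B) A : Bfin mu :=
  exist _ (B `&` sval A)
    (Bfin_subset (measurableI _ _ mB (measurable_Bfin A)) (@subIsetr _ B _)).

Lemma rk_additive F A B C : rk_mem H F -> sval C = sval A `|` sval B ->
  sval A `&` sval B = set0 -> F C = F A + F B.
Proof.
move=> HF CAB AB0; have HA := rk_kernel_mem H A; have HB := rk_kernel_mem H B.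
rewrite !(rk_reproducing _ HF) (rk_innerC HF HA) (rk_innerC HF HB).
rewrite -rk_innerDl// [RHS]rk_innerC//; last exact: rk_memD.
congr rk_inner; apply/funext => D; rewrite /Kmu CAB setIUr measureU.
- rewrite fineD//.
  + exact: (Bfin_fin_num (Bfin_setIr (measurable_Bfin D) A)).
  + exact: (Bfin_fin_num (Bfin_setIr (measurable_Bfin D) B)).
- exact: measurableI (measurable_Bfin _) (measurable_Bfin _).
- exact: measurableI (measurable_Bfin _) (measurable_Bfin _).
- by rewrite setIACA AB0 setI0.
Qed.

(** Cauchy-Schwarz against the kernel function at [A], whose squared norm is [Kmu mu A A], the
    measure of [A]. *)
Lemma rk_sqr_le F A : rk_mem H F ->
  F A ^+ 2 <= fine (mu (sval A)) * rk_inner H F F.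
Proof.
move=> HF; have HA := rk_kernel_mem H A.
rewrite (rk_reproducing A HF) mulrC.
apply: le_trans (rk_cauchy_schwarz HF HA) _.
by rewrite -(rk_reproducing A HA) /Kmu setIid.
Qed.

Lemma rk_null F A : rk_mem H F -> mu (sval A) = 0%E -> F A = 0.
Proof.
move=> HF A0; have := rk_sqr_le A HF; rewrite A0 mul0r => FA0.
by apply/eqP; rewrite -sqrf_eq0 eq_le FA0 sqr_ge0.
Qed.

(** The increment of [F] from [B n] to [A] is its value on the difference set, controlled by the
    measure of that set through [rk_sqr_le]. This measure tends to 0 by continuity from above, as
    [A] has finite measure. *)
Lemma rk_continuous_from_below F A (B : nat -> Bfin mu) : rk_mem H F ->
  {homo (fun n => sval (B n)) : m n / (m <= n)%N >-> m `<=` n} ->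
  sval A = \bigcup_n sval (B n) -> F (B n) @[n --> \oo] --> F A.
Proof.
move=> HF ndB AB.
have mD n : measurable (sval A `\` sval (B n)).
  by apply: measurableD; exact: measurable_Bfin.
have DA n : sval A `\` sval (B n) `<=` sval A by exact: subDsetl.
pose D n : Bfin mu := exist _ _ (Bfin_subset (mD n) (DA n)).
have FD n : F A - F (B n) = F (D n).
  suff -> : F A = F (B n) + F (D n) by rewrite addrAC subrr add0r.
  apply: (rk_additive HF).
    by rewrite [sval (D n)]/= setDUK// AB => x Bx; exists n.
  by apply/seteqP; split => // x [Bx [_ /(_ Bx)]].
have D0 : mu (sval (D n)) @[n --> \oo] --> 0%E.
  have E0 : \bigcap_n sval (D n) = set0.
    apply/seteqP; split => // x Dx; have [+ _] := Dx 0%N I.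
    by rewrite AB => -[n _ Bx]; have [_] := Dx n I.
  rewrite -(measure0 mu) -E0; apply: nonincreasing_cvg_mu.
  - exact: (svalP (D 0%N)).2.
  - by move=> n; exact: measurable_Bfin.
  - by rewrite E0.
  - move=> m n mn; apply/subsetPset => x [Ax nBx]; split => // Bx; apply: nBx.
    exact: ndB Bx.
have D0' : fine (mu (sval (D n))) @[n --> \oo] --> (0 : R) by exact: fine_cvg D0.
have : F (B n) - F A @[n --> \oo] --> (0 : R).
  apply: (@cvg0_sqr_le R _ (fun n => fine (mu (sval (D n)))) (rk_inner H F F)).
    by move=> n; rewrite -sqrrN opprB FD; exact: rk_sqr_le.
  exact: D0'.
by move/cvg_sub0; apply; exact: cvg_cst.
Qed.

Theorem rk_sigma_additive F A (B : nat -> Bfin mu) : rk_mem H F ->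
  trivIset setT (fun i => sval (B i)) -> sval A = \bigcup_i sval (B i) ->
  (fun n => \sum_(0 <= i < n) F (B i)) @ \oo --> F A.
Proof.
move=> HF tB AB.
have mU n : measurable (\big[setU/set0]_(i < n) sval (B i)).
  by apply: bigsetU_measurable => i _; exact: measurable_Bfin.
have UA n : \big[setU/set0]_(i < n) sval (B i) `<=` sval A.
  by rewrite AB; exact: bigsetU_bigcup.
pose U n : Bfin mu := exist _ _ (Bfin_subset (mU n) (UA n)).
have FU n : \sum_(0 <= i < n) F (B i) = F (U n).
  elim: n => [|n IH].
    by rewrite big_nil (rk_null HF)//= big_ord0 measure0.
  rewrite big_nat_recr//= IH; apply/esym/rk_additive => //=.
    by rewrite big_ord_recr.
  rewrite big_distrl/= big1// => i _; apply/eqP; rewrite -[_ == _]negbK.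
  apply/negP => /set0P ne; have := tB i n I I ne => in'.
  by have := ltn_ord i; rewrite in' ltnn.
under eq_fun do rewrite FU.
apply: rk_continuous_from_below => //=.
  by move=> m n mn; exact: (@subset_bigsetU _ (fun i => sval (B i)) m n mn).
(* [bigcup_bigsetU_bigcup] takes the partial unions over indices below [n.+1], whereas [U n] stops
   below [n]; hence the shift by one. *)
rewrite AB -bigcup_bigsetU_bigcup; apply/seteqP; split => x [n _ Ux].
  by exists n.+1.
by exists n => //; exact: (@subset_bigsetU _ (fun i => sval (B i)) _ _ (leqnSn n)).
Qed.

(** Local-to-global principle: by countable additivity [F A] is the sum of the values on the pieces
    of [A] cut out by the partition. Applied to a difference, it globalizes an identity known only
    inside each piece. *)
Lemma rk_eq0_on_cover F A (W : nat -> set T) : rk_mem H F ->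
  (forall i, measurable (W i)) -> trivIset setT W -> \bigcup_i W i = setT ->
  (forall B, (exists i, sval B `<=` sval A `&` W i) -> F B = 0) -> F A = 0.
Proof.
move=> HF mW tW cW F0.
pose B i := Bfin_setIr (mW i) A.
have FB i : F (B i) = 0 by apply: F0; exists i => x [].
have tB : trivIset setT (fun i => sval (B i)).
  exact: trivIset_setIr.
have AB : sval A = \bigcup_i sval (B i) by rewrite -setI_bigcupl cW setTI.
have := rk_sigma_additive HF tB AB.
under eq_fun do rewrite big1//; move=> /cvg_unique; apply => //.
exact: cvg_cst.
Qed.

End rkhs_set_functions.

(** * Radon-Nikodym densities on a set of finite measure *)

Section trace_charge.
Set Implicit Arguments. Unset Strict Implicit.
Context d (T : measurableType d) (R : realType).
Variable mu : {measure set T -> \bar R}.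
Variables (H : RKHS (Kmu mu)) (F : Bfin mu -> R) (HF : rk_mem H F).
Variable W : Bfin mu.

(* The unused proof argument lets the charge structure be inferred from the
   term; the value 0 on non-measurable sets is junk. *)
Definition trace (HF : rk_mem H F) (A : set T) : \bar R :=
  if pselect (measurable A) is left mA then (F (Bfin_setIr mA W))%:E else 0%E.

Let traceE (A : set T) (mA : measurable A) :
  trace HF A = (F (Bfin_setIr mA W))%:E.
Proof.
by rewrite /trace; case: pselect => // mA'; rewrite (Prop_irrelevance mA' mA).
Qed.

Let trace0 : trace HF set0 = 0%E.
Proof.
by rewrite (traceE measurable0) (rk_null HF)//= set0I measure0.
Qed.

Let trace_fin (A : set T) : measurable A -> trace HF A \is a fin_num.
Proof. by move=> mA; rewrite (traceE mA). Qed.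

Let trace_sigma_additive : semi_sigma_additive (trace HF).
Proof.
move=> A mA tA mUA; rewrite (traceE mUA).
pose B i := Bfin_setIr (mA i) W.
have tB : trivIset setT (fun i => sval (B i)) by exact: trivIset_setIr.
have UB : sval (Bfin_setIr mUA W) = \bigcup_i sval (B i).
  exact: setI_bigcupl.
apply: cvg_EFin; first by apply: nearW => n; apply/sum_fin_numP => i _ _;
  exact: trace_fin.
apply: cvg_trans (rk_sigma_additive HF tB UB).
apply: near_eq_cvg; apply: nearW => n /=.
rewrite (eq_bigr (fun i => (F (B i))%:E)) ?sumEFin// => i _.
exact: traceE.
Qed.

HB.instance Definition _ :=
  isCharge.Build d T R (trace HF) trace0 trace_fin trace_sigma_additive.

(* Alias carrying the bundled structure that [Radon_Nikodym] requires. *)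
Definition sigma_finite_copy (sf : sigma_finite setT mu) : set T -> \bar R := mu.

HB.instance Definition _ sf := Measure.copy (sigma_finite_copy sf) mu.

HB.instance Definition _ sf :=
  Measure_isSigmaFinite.Build d T R (sigma_finite_copy sf) sf.

(** [F] is defined on sets of finite measure only; intersecting with [W] yields a finite charge on
    the whole sigma-algebra, dominated by [mu] because [F] vanishes on null sets. *)
Lemma rk_local_density : sigma_finite setT mu ->
  exists f : T -> R, measurable_fun setT f /\
    forall A : Bfin mu, sval A `<=` sval W -> F A = Rintegral mu (sval A) f.
Proof.
move=> sf.
pose mu' : {sigma_finite_measure set T -> \bar R} := sigma_finite_copy sf.
have dom : trace HF `<< mu'.
  apply/null_content_dominatesP => A mA A0; rewrite (traceE mA).
  rewrite (rk_null HF)//=; apply: subset_measure0 A0 => //.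
  by apply: measurableI => //; exact: measurable_Bfin.
have fin x := Radon_Nikodym_fin_num x dom.
have int := Radon_Nikodym_integrable dom.
exists (fun x => fine (Radon_Nikodym (trace HF) mu' x)); split.
  by apply: measurableT_comp => //; exact: measurable_int int.
move=> A AW; have mA := measurable_Bfin A.
apply: EFin_inj; rewrite /Rintegral fineK.
  transitivity (trace HF (sval A)).
    rewrite (traceE mA); congr (F _)%:E; apply: Bfin_inj => /=.
    by rewrite setIidl.
  rewrite (Radon_Nikodym_integral dom mA); apply: eq_integral => x _.
  by rewrite fineK.
rewrite (eq_integral (Radon_Nikodym (trace HF) mu')); last first.
  by move=> x _; rewrite fineK.
by apply: integrable_fin_num => //; exact: integrableS int.
Qed.

End trace_charge.

(** * Gluing the local densities and square integrability *)

Section radon_nikodym_density.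
Set Implicit Arguments. Unset Strict Implicit.
Context d (T : measurableType d) (R : realType).
Variable mu : {measure set T -> \bar R}.
Variable H : RKHS (Kmu mu).
Implicit Types F G : Bfin mu -> R.

Lemma L2_restrict (E : set T) h : measurable E -> L2 mu h ->
  L2 mu (fun x => h x * \1_E x).
Proof.
move=> mE lh; have [mh _] := lh; apply: L2_le lh.
  by apply: measurable_funM => //; exact: measurable_indic.
move=> x; rewrite normrM ler_piMr// indicE.
by case: (_ \in _); rewrite ?normr1 ?normr0.
Qed.

(** Induction on [h]: when [h] is the indicator of [A], the reproducing property turns the product
    into the value of [G] on the part of [A] inside [E], which is 0. *)
Lemma rk_orthogonal_of_eq0 G (E : set T) h : rk_mem H G -> measurable E ->
  (forall A : Bfin mu, sval A `<=` E -> G A = 0) -> L2 mu h ->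
  rk_inner H G (integral_on mu (fun x => h x * \1_E x)) = 0.
Proof.
move=> HG mE G0; move: h.
have HJ f (lf : L2 mu f) := rk_mem_integral_on H (L2_restrict mE lf).
apply: L2_induction => [A|f g lf lg f0 g0|a f lf f0|u f lu lf u0 uf].
- have -> : (fun x => \1_(sval A) x * \1_E x) =
      \1_(sval (Bfin_setIr mE A)) :> (T -> R).
    by apply/funext => x; rewrite /= setIC indicI.
  rewrite integral_on_indic -rk_reproducing// G0//=; exact: subIsetl.
- have -> : (fun x => (f x + g x) * \1_E x) =
      (fun x => f x * \1_E x + g x * \1_E x).
    by apply/funext => x; rewrite mulrDl.
  have lf' := L2_restrict mE lf; have lg' := L2_restrict mE lg.
  have Hf := HJ _ lf; have Hg := HJ _ lg.
  rewrite integral_onD// rk_innerC//; last exact: rk_memD.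
  by rewrite rk_innerDl// !(rk_innerC _ HG)// f0 g0 addr0.
- have -> : (fun x => (a * f x) * \1_E x) = (fun x => a * (f x * \1_E x)).
    by apply/funext => x; rewrite mulrA.
  have lf' := L2_restrict mE lf; have Hf := HJ _ lf.
  rewrite integral_onZ// rk_innerC//; last exact: rk_memZ.
  by rewrite rk_innerZl// (rk_innerC _ HG)// f0 mulr0.
- have lf' := L2_restrict mE lf; have Hf := HJ _ lf.
  (* A constant sequence tending to 0 is 0. As the product for [u n] vanishes, the product for [f]
     equals up to sign that for [u n - f], which is small by Cauchy-Schwarz and the isometry. *)
  have : (fun _ : nat => rk_inner H G (integral_on mu (fun x => f x * \1_E x)))
      @ \oo --> (0 : R).
    apply: (@cvg0_sqr_le R _ _ (rk_inner H G G)) uf => n.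
    have lB : L2 mu (fun x => u n x - f x) by exact: L2B.
    have lB' := L2_restrict mE lB; have HB := HJ _ lB.
    have -> : rk_inner H G (integral_on mu (fun x => f x * \1_E x)) ^+ 2 =
        rk_inner H (integral_on mu (fun x => (u n x - f x) * \1_E x)) G ^+ 2.
      have lu' := L2_restrict mE (lu n); have Hu := HJ _ (lu n).
      have -> : (fun x => (u n x - f x) * \1_E x) =
          (fun x => u n x * \1_E x - f x * \1_E x).
        by apply/funext => x; rewrite mulrBl.
      rewrite integral_onB// rk_innerBl// !(rk_innerC _ HG)// !(rk_innerC HG)//.
      by rewrite (rk_innerC Hu HG) u0 sub0r sqrrN (rk_innerC Hf HG).
    apply: le_trans (rk_cauchy_schwarz HB HG) _.
    rewrite rk_inner_integral_on// ler_wpM2r ?rk_inner_ge0//.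
    apply: le_Rintegral => //; first exact: L2_integrableM.
      exact: L2_integrableM.
    move=> x _; rewrite indicE.
    by case: (_ \in _); rewrite ?mulr1// mulr0 mul0r -expr2 sqr_ge0.
  by move/(cvg_unique (@Rhausdorff R) (cvg_cst _))=> <-.
Qed.

(** An exhaustion by sets of finite measure is made disjoint and the densities on the pieces are
    glued. The formula is claimed inside single pieces only, since integrability of the glued [phi]
    on larger sets is not yet known. *)
Lemma rk_locally_integral F : sigma_finite setT mu -> rk_mem H F ->
  exists (W : nat -> Bfin mu) (phi : T -> R), [/\ measurable_fun setT phi,
    trivIset setT (fun i => sval (W i)), \bigcup_i sval (W i) = setT &
    forall (A : Bfin mu) i, sval A `<=` sval (W i) ->
      F A = Rintegral mu (sval A) phi].
Proof.
move=> sf HF; have [V [VT ndV mV]] := (sigma_finiteP _ _).1 sf.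
have mW i : measurable (seqD V i).
  by case: i => [|i]; [|apply: measurableD]; exact: (mV _).1.
have WV i : seqD V i `<=` V i by case: i => // i; exact: subDsetl.
pose VB i : Bfin mu := exist _ (V i) (mV i).
pose W i : Bfin mu := exist _ _ (@Bfin_subset _ _ _ mu (VB i) _ (mW i) (WV i)).
have tW : trivIset setT (fun i => sval (W i)) by exact: trivIset_seqD.
have cW : \bigcup_i sval (W i) = setT by rewrite eq_bigcup_seqD -VT.
have [f fP] := choice (fun i => rk_local_density HF (W i) sf).
have ex x : exists i, sval (W i) x.
  have : [set: T] x by []; rewrite -cW => -[i _ Wx]; by exists i.
(* [k x] is the index of the piece containing [x], unique by disjointness. *)
have [k kP] := choice ex.
have phiE x i : sval (W i) x -> f (k x) x = f i x.
  move=> Wx; congr (f _ x); apply: tW => //; exists x; split => //.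
exists W, (fun x => f (k x) x); split => //.
  rewrite -cW; apply/measurable_fun_bigcup => i.
    exact: measurable_Bfin.
  apply: (eq_measurable_fun (f i)).
    by move=> x /[!inE] Wx; rewrite (phiE x i).
  by apply: measurable_funS (fP i).1.
move=> A i AW; rewrite ((fP i).2 A AW); apply: eq_Rintegral => x /[!inE] Ax.
by rewrite (phiE x i)//; exact: AW.
Qed.

Theorem rk_mem_integral F : sigma_finite setT mu -> rk_mem H F ->
  exists2 phi, L2 mu phi & F = integral_on mu phi.
Proof.
move=> sf HF; have [W [phi [mphi tW cW Fphi]]] := rk_locally_integral sf HF.
have mW i : measurable (sval (W i)) by exact: measurable_Bfin.
have [V [VT ndV mV]] := (sigma_finiteP _ _).1 sf.
(* On [E n] both the measure and [phi] are bounded, so the cut-off [psi n] is dominated by [n] times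
   an indicator in L2. The [E n] increase and exhaust the space. *)
pose E n := V n `&` [set x | `|phi x| <= n%:R].
have mE n : measurable (E n).
  apply: measurableI; first exact: (mV n).1.
  rewrite -[X in measurable X]setTI.
  have mn : measurable_fun setT (fun x => `|phi x|) by exact: measurableT_comp.
  exact: measurable_fun_le mn (measurable_cst _).
have EV n : E n `<=` V n by exact: subIsetl.
pose VB n : Bfin mu := exist _ (V n) (mV n).
pose EB n : Bfin mu := exist _ _ (@Bfin_subset _ _ _ mu (VB n) _ (mE n) (EV n)).
pose psi n x := phi x * \1_(E n) x.
have mpsi n : measurable_fun setT (psi n).
  by apply: measurable_funM => //; exact: measurable_indic.
have lpsi n : L2 mu (psi n).
  apply: L2_le (mpsi n) _ (L2Z n%:R (L2_indic (EB n))) => x.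
  rewrite /psi /= indicE; case: (boolP (x \in E n)) => [|_].
    by rewrite inE => -[_ /=]; rewrite !mulr1 => /le_trans; apply; exact: ler_norm.
  by rewrite !mulr0.
(* A subset of [E n] may meet infinitely many pieces [W i]; [rk_eq0_on_cover] reassembles them. *)
have eqF f : L2 mu f -> (forall n, (forall x, E n x -> f x = phi x) ->
    forall A : Bfin mu, sval A `<=` E n -> F A = integral_on mu f A).
  move=> lf n fphi A AE; have Hf := rk_mem_integral_on H lf.
  apply/eqP; rewrite -subr_eq0; apply/eqP.
  apply: (rk_eq0_on_cover (rk_memB HF Hf) mW tW cW) => B [i BAW].
  rewrite (Fphi B i); last by move=> x /BAW[].
  apply/eqP; rewrite subr_eq0; apply/eqP; apply: eq_Rintegral => x /[!inE] Bx.
  by apply/esym/fphi/AE; have [] := BAW _ Bx.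
have psi_le n : dotL2 mu (psi n) (psi n) <= rk_inner H F F.
  have Hpsi := rk_mem_integral_on H (lpsi n).
  have psiE : (fun x => psi n x * \1_(E n) x) = psi n.
    apply/funext => x; rewrite /psi indicE.
    by case: (_ \in _); rewrite ?mulr1 ?mulr0.
  have := @rk_orthogonal_of_eq0 _ _ _ (rk_memB HF Hpsi) (mE n) _ (lpsi n).
  rewrite psiE rk_innerBl// rk_inner_integral_on// => /(_ _)/eqP.
  rewrite subr_eq0 => /(_ _)/eqP psi0.
  have Fpsi : rk_inner H F (integral_on mu (psi n)) = dotL2 mu (psi n) (psi n).
    apply: psi0 => A AE; rewrite (eqF _ (lpsi n) n) ?subrr// => x Ex.
    by rewrite /psi indicE mem_set// mulr1.
  (* By orthogonality the product of [F] with the image of [psi n] is the squared norm of [psi n].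
     Cauchy-Schwarz then has this squared norm as a factor on both sides, cancelled when
     positive. *)
  have := rk_cauchy_schwarz HF Hpsi.
  rewrite Fpsi rk_inner_integral_on// expr2.
  have := dotL2_ge0 mu (psi n); rewrite le_eqVlt => /predU1P[<-|p0].
    by rewrite rk_inner_ge0.
  by rewrite ler_pM2r.
have ndE m n x : (m <= n)%N -> E m x -> E n x.
  move=> mn [Vx /= phix]; split; first by move/subsetPset: (ndV _ _ mn); apply.
  by apply: le_trans phix _; rewrite ler_nat.
have psi_eq x : \forall n \near \oo, psi n x = phi x.
  have : [set: T] x by [].
  rewrite VT => -[m _ Vx].
  near=> n; rewrite /psi indicE mem_set ?mulr1//; split.
    have mn : (m <= n)%N by near: n; exact: nbhs_infty_ge.
    by move/subsetPset: (ndV _ _ mn); apply.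
  by near: n; exact: nbhs_infty_ger.
have psi2_nd x m n : (m <= n)%N -> psi m x * psi m x <= psi n x * psi n x.
  move=> mn; rewrite /psi !indicE; case: (boolP (x \in E m)) => [|_].
    by rewrite inE => /(ndE _ _ _ mn)/mem_set ->.
  by rewrite !mulr0 -expr2 sqr_ge0.
have lphi : L2 mu phi.
  apply/(L2_sqrP mu mphi); apply: (@le_lt_trans _ _ (rk_inner H F F)%:E).
    (* The squares of [psi n] increase to that of [phi], so the uniform bound [psi_le] passes to the
       limit. *)
    have := @cvg_monotone_convergence _ _ _ mu setT measurableT
      (fun n x => (psi n x * psi n x)%:E).
    have -> : (fun x => limn (fun n => (psi n x * psi n x)%:E)) =
        (fun x => (phi x * phi x)%:E).
      apply/funext => x; apply/cvg_lim => //; apply: cvg_near_cst.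
      by near=> n; rewrite (near (psi_eq x) n).
    move=> /(_ _ _ _)/cvg_lim <- //; last 3 first.
    - by move=> n; apply/measurable_EFinP; exact: measurable_funM.
    - by move=> n x _; rewrite lee_fin -expr2 sqr_ge0.
    - by move=> x _ m n mn; rewrite lee_fin psi2_nd.
    apply: lime_le.
      apply: ereal_nondecreasing_is_cvgn => m n mn; apply: ge0_le_integral => //.
      - by move=> x _; rewrite lee_fin -expr2 sqr_ge0.
      - by apply/measurable_EFinP; exact: measurable_funM.
      - by apply/measurable_EFinP; exact: measurable_funM.
      - by move=> x _; rewrite lee_fin psi2_nd.
    apply: nearW => n.
    rewrite -[leLHS]fineK ?lee_fin//; first exact: psi_le.
    by apply: integrable_fin_num => //; exact: L2_integrableM.
  exact: ltry.
exists phi => //; apply/funext => A.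
have Hphi := rk_mem_integral_on H lphi.
apply/eqP; rewrite -subr_eq0; apply/eqP.
apply: (rk_eq0_on_cover (rk_memB HF Hphi) mW tW cW) => B [i BAW].
by rewrite (Fphi B i) ?subrr// => x /BAW[].
Unshelve. all: by end_near. Qed.

End radon_nikodym_density.

(** * Assembly of the characterization *)

Theorem mainTheorem2 (d : measure_display) (T : measurableType d) (R : realType)
  (mu : {measure set T -> \bar R}) (Hsf : sigma_finite setT mu)
  (H : RKHS (Kmu mu)) :
  (* membership characterization *)
  (forall F : Bfin mu -> R,
     rk_mem H F <->
     exists phi : T -> R, L2 mu phi /\
       forall A : Bfin mu, F A = Rintegral mu (sval A) phi) /\
  (* uniqueness a.e. of dF/dmu and equality of norms *)
  (forall (F : Bfin mu -> R) (phi : T -> R), rk_mem H F -> L2 mu phi ->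
     (forall A : Bfin mu, F A = Rintegral mu (sval A) phi) ->
     (forall psi : T -> R, L2 mu psi ->
        (forall A : Bfin mu, F A = Rintegral mu (sval A) psi) ->
        phi = psi %[ae mu]) /\
     rk_norm H F = L2norm mu phi) /\
  (* countable additivity and vanishing on null sets *)
  (forall F : Bfin mu -> R, rk_mem H F ->
     (forall (A : Bfin mu) (Ai : nat -> Bfin mu),
        trivIset setT (fun i => sval (Ai i)) ->
        sval A = \bigcup_i sval (Ai i) ->
        (fun n => \sum_(0 <= i < n) F (Ai i)) @ \oo --> F A) /\
     (forall A : Bfin mu, mu (sval A) = 0%E -> F A = 0)).
Proof.
have uniq (F : Bfin mu -> R) phi :
    (forall A, F A = Rintegral mu (sval A) phi) -> F = integral_on mu phi.
  by move=> Fphi; apply/funext.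
split=> [F|]; last split=> [F phi HF lphi /uniq Fphi|F HF].
- split=> [HF|[phi [lphi /uniq ->]]]; last exact: rk_mem_integral_on.
  by have [phi lphi ->] := rk_mem_integral Hsf HF; exists phi.
- split=> [psi lpsi /uniq Fpsi|].
    by apply: (integral_on_inj H) => //; rewrite -Fphi.
  by rewrite /rk_norm dotL2_norm// Fphi rk_inner_integral_on.
- split=> [A B tB AB|A A0]; first exact: rk_sigma_additive HF tB AB.
  exact: rk_null HF A0.
Qed.
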